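(* Let $L\subseteq\mathbb Z^4$ be a positive lattice of rank three with an admissible basis $\{\mathbf c_1,\mathbf c_2,\mathbf c_3\}$. Let $\mu$ and $\lambda$ be positive integers, and assume that the first and fourth coordinates of the vector $\mathbf u^{(\mu,\lambda)}=\mu\mathbf c_1+\mathbf c_2+\lambda\mathbf c_3$ are positive. Then $\mathbf u^{(\mu,\lambda)}$ is a neighbor of the origin in $L$ if and only if $\mu=1$ and $\lambda\le2$.
   Context: A lattice (subgroup) $L\subseteq\mathbb Z^r$ is positive if $L\cap\mathbb N^r=\{\mathbf 0\}$. A $\mathbb Z$-basis $\{\mathbf c_1,\mathbf c_2,\mathbf c_3\}$ of a rank-three lattice $L\subseteq\mathbb Z^4$ is admissible if $\mathbf c_1=(\alpha_{11},-\alpha_{12},-\alpha_{13},-\alpha_{14})$, $\mathbf c_2=(-\alpha_{21},-\alpha_{22},-\alpha_{23},\alpha_{24})$, $\mathbf c_3=(-\alpha_{31},\alpha_{32},-\alpha_{33},-\alpha_{34})$ with every $\alpha_{ij}$ a positive integer, and: (I) $\alpha_{11}>\alpha_{21}+2\alpha_{31}$; (II) $\max(\alpha_{12},\alpha_{22})<\alpha_{32}<\alpha_{12}+\alpha_{22}$; (III) $\alpha_{24}>\alpha_{14}+2\alpha_{34}$. Neighbors of the origin: for a nonempty finite subset $J\subseteq L$, $\max(J)$ is the coordinatewise maximum of the elements of $J$. Let $\Delta_L$ be the collection of finite subsets $J\subseteq L$ such that $\max(J)\ne\max(J')$ for every finite subset $J'\subseteq L$ with $J'\ne J$. A vector $\mathbf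 u\in L\setminus\{\mathbf 0\}$ is a neighbor of the origin if $\{\mathbf 0,\mathbf u\}\in\Delta_L$. *)

(* Defs.v *)
From mathcomp Require Import all_boot all_order all_algebra finmap.

Set Implicit Arguments.
Unset Strict Implicit.
Unset Printing Implicit Defensive.

Import Order.TTheory GRing.Theory Num.Theory.
Local Open Scope ring_scope.

(* A lattice in Z^r is a subgroup of the additive group 'rV[int]_r. *)

Definition positive_lattice r (L : zmodClosed 'rV[int]_r) : Prop :=
  forall v : 'rV[int]_r,
    (v \in L /\ forall i, 0 <= v 0 i) <-> v = 0.

Definition Zbasis r n (L : zmodClosed 'rV[int]_r) (b : 'I_n -> 'rV[int]_r) :
    Prop :=
  [/\ forall i, b i \in L,
      forall v, v \in L -> exists a : 'I_n -> int, v = \sum_i a i *: b i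
    & forall a : 'I_n -> int, \sum_i a i *: b i = 0 -> forall i, a i = 0].

Definition has_rank r (L : zmodClosed 'rV[int]_r) (n : nat) : Prop :=
  exists b : 'I_n -> 'rV[int]_r, Zbasis L b.

Definition vec4 (a b c d : int) : 'rV[int]_4 :=
  \row_(j < 4) nth 0 [:: a; b; c; d] j.

(* The sign pattern and (I)-(III) depend on the order of c1, c2, c3; the       *)
(* positive entry of c2 is its fourth one, that of c3 its second one.          *)
Definition admissible (L : zmodClosed 'rV[int]_4) (c1 c2 c3 : 'rV[int]_4) :
    Prop :=
  Zbasis L (fun i : 'I_3 => nth 0 [:: c1; c2; c3] i) /\
  exists a11 a12 a13 a14 a21 a22 a23 a24 a31 a32 a33 a34 : int,
    [/\ [/\ c1 = vec4 a11 (- a12) (- a13) (- a14),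
            c2 = vec4 (- a21) (- a22) (- a23) a24
          & c3 = vec4 (- a31) a32 (- a33) (- a34)],
        all (fun a : int => 0 < a)
          [:: a11; a12; a13; a14; a21; a22; a23; a24; a31; a32; a33; a34],
        a11 > a21 + 2 * a31,
        Num.max a12 a22 < a32 < a12 + a22
      & a24 > a14 + 2 * a34].

(* Since int has no least element, the iterated maximum starts from the first  *)
(* element of J; this is the coordinatewise maximum when J is nonempty (see    *)
(* fset_maxP), and a junk value when J is empty.                               *)
Definition fset_max r (J : {fset 'rV[int]_r}) : 'rV[int]_r :=
  \row_i \big[Num.max/(head 0 (J : seq 'rV[int]_r)) 0 i]_(x <- J) x 0 i.

Lemma fset_maxP r (J : {fset 'rV[int]_r}) (m : 'rV[int]_r) :
  J != fset0 ->
  fset_max J = m <->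
  forall i, (exists2 x, x \in J & x 0 i = m 0 i) /\
            (forall x, x \in J -> x 0 i <= m 0 i).
Proof.
move=> J0.
have hJ : head 0 (J : seq 'rV[int]_r) \in J.
  move: J0; rewrite -cardfs_gt0.
  rewrite -[_ \in J]/(_ \in (J : seq _)).
  by case: (J : seq _) => //= x s _; rewrite mem_head.
have P i : (exists2 x, x \in J & x 0 i = fset_max J 0 i) /\
            (forall x, x \in J -> x 0 i <= fset_max J 0 i).
  rewrite mxE; split; last first.
    by move=> x xJ; exact: (le_bigmax_seq _ x predT (fun x : 'rV[int]_r => x 0 i)).
  rewrite big_seq; elim/big_ind: _ => [|a b [x xJ <-] [y yJ <-]|x xJ].
  - by exists (head 0 (J : seq 'rV[int]_r)).
  - by case: (leP (x 0 i) (y 0 i)) => _; [exists y | exists x].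
  - by exists x.
split=> [<- //|Q]; apply/rowP=> i.
have [[x xJ ex] ux] := P i; have [[y yJ ey] uy] := Q i.
by apply/eqP; rewrite eq_le -{1}ex uy // -ey ux.
Qed.

Definition in_Delta r (L : zmodClosed 'rV[int]_r) (J : {fset 'rV[int]_r}) :
    Prop :=
  [/\ J != fset0,
      {subset J <= L}
    & forall J' : {fset 'rV[int]_r},
        J' != fset0 -> {subset J' <= L} -> J' <> J ->
        fset_max J <> fset_max J'].

Definition neighbor r (L : zmodClosed 'rV[int]_r) (u : 'rV[int]_r) : Prop :=
  [/\ u \in L, u <> 0 & in_Delta L [fset 0; u]%fset].

(* Main.v *)
Require Import Defs.
From mathcomp Require Import all_boot all_order all_algebra finmap.
From mathcomp Require Import zify ring.

(** Since [u] has coordinates of both signs, it is a neighbor of the origin iff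
    0 and [u] are the only lattice vectors [w] below [max(0, u)].
    If [mu >= 2], or [mu = 1] and [lambda >= 3], one of [c1], [c3], [c1 + c3] is
    a further such vector.  Conversely, write [w = x c1 + y c2 + z c3] and
    subtract [u = c1 + c2 + lambda c3].  By (I) and (III), the first and fourth
    coordinates bound [max (x - 1) (y - 1)] by less than half of [z - lambda]
    when [z > lambda], by 0 when [z = lambda], and by a negative number when
    [z < lambda]; the second and third coordinates, together with (II), exclude
    everything but 0 and [u]. *)

Set Implicit Arguments.
Unset Strict Implicit.
Unset Printing Implicit Defensive.

Import Order.TTheory GRing.Theory Num.Theory.
Local Open Scope ring_scope.

Lemma fset_max_pair r (u : 'rV[int]_r) i :
  fset_max [fset 0; u]%fset 0 i = Num.max 0 (u 0 i).
Proof.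
have J0 : [fset 0; u]%fset != fset0 :> {fset 'rV[int]_r}.
  by apply/fset0Pn; exists 0; rewrite !inE eqxx.
suff -> : fset_max [fset 0; u]%fset = \row_i Num.max 0 (u 0 i) by rewrite mxE.
apply/(fset_maxP _ J0) => j; rewrite mxE; split=> [|x].
  case: (leP 0 (u 0 j)) => _; [exists u | exists 0] => //;
  by rewrite ?mxE // !inE eqxx ?orbT.
by rewrite !inE => /orP[] /eqP ->; rewrite ?mxE le_max lexx ?orbT.
Qed.

(** A third vector below the maximum can be added to the pair without changing it. Conversely, any
    [J'] with this maximum lies in the pair; only [u] attains it at [p], and only 0 at [n]. *)
Lemma neighborP r (L : zmodClosed 'rV[int]_r) (u : 'rV[int]_r) (p n : 'I_r) :
  u \in L -> 0 < u 0 p -> u 0 n < 0 ->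
  neighbor L u <->
  forall w, w \in L -> (forall i, w 0 i <= Num.max 0 (u 0 i)) ->
    w = 0 \/ w = u.
Proof.
move=> uL up un.
have J0 : [fset 0; u]%fset != fset0 :> {fset 'rV[int]_r}.
  by apply/fset0Pn; exists 0; rewrite !inE eqxx.
have JL : {subset [fset 0; u]%fset <= L}.
  by move=> x; rewrite !inE => /orP[] /eqP -> //; exact: rpred0.
split=> [[_ _ [_ _ uniq_max]] w wL wle | only].
  have [->|w0] := eqVneq w 0; first by left.
  have [->|wu] := eqVneq w u; first by right.
  have Jw0 : (w |` [fset 0; u])%fset != fset0 :> {fset 'rV[int]_r}.
    by apply/fset0Pn; exists w; rewrite !inE eqxx.
  case: (uniq_max (w |` [fset 0; u])%fset) => //.
  - by move=> x; rewrite in_fset1U => /orP[/eqP -> //|]; exact: JL.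
  - move=> E; have : w \in [fset 0; u]%fset by rewrite -E !inE eqxx.
    by rewrite !inE (negPf w0) (negPf wu).
  apply/esym/(fset_maxP _ Jw0) => i; split.
    have [[x xJ ex] _] := (fset_maxP _ J0).1 erefl i.
    by exists x => //; rewrite in_fset1U xJ orbT.
  move=> x; rewrite in_fset1U => /orP[/eqP ->|xJ].
    by rewrite fset_max_pair.
  by have [_] := (fset_maxP _ J0).1 erefl i; apply.
split=> //; first by move=> u0; move: up; rewrite u0 mxE ltxx.
split=> // J' J'0 J'L J'J /esym/(fset_maxP _ J'0) J'max; apply: J'J.
have J'sub x : x \in J' -> x = 0 \/ x = u.
  move=> xJ'; apply: only; first exact: J'L.
  by move=> i; rewrite -fset_max_pair; apply: (J'max i).2.
have uJ' : u \in J'.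
  have [[x xJ' ex] _] := J'max p.
  have [x0|<- //] := J'sub _ xJ'.
  by move: ex; rewrite fset_max_pair x0 mxE (max_r (ltW up)) => e0;
    rewrite -e0 ltxx in up.
have oJ' : 0 \in J'.
  have [[x xJ' ex] _] := J'max n.
  have [<- //|xu] := J'sub _ xJ'.
  by move: ex; rewrite fset_max_pair xu (max_l (ltW un)) => e0;
    rewrite e0 ltxx in un.
apply/fsetP => x; rewrite !inE; apply/idP/orP.
  by move=> /J'sub [] ->; rewrite eqxx; [left | right].
by case=> /eqP ->.
Qed.

Lemma lt_half_of_dominated (d a m z : int) :
  0 < a -> 2 * a < d -> d * m <= a * z ->
  [/\ z <= 0 -> m <= 0, z < 0 -> m < 0 & 0 < z -> 2 * m < z].
Proof. by move=> a0 ad dm; split=> z0; nia. Qed.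

Lemma max_lt_half_of_dominated (a11 a21 a31 a14 a24 a34 x y z : int) :
  0 < a21 -> 0 < a31 -> 0 < a14 -> 0 < a34 ->
  a21 + 2 * a31 < a11 -> a14 + 2 * a34 < a24 ->
  a11 * x <= a21 * y + a31 * z -> a24 * y <= a14 * x + a34 * z ->
  [/\ z <= 0 -> x <= 0 /\ y <= 0,
      z < 0 -> x < 0 /\ y < 0
    & 0 < z -> 2 * x < z /\ 2 * y < z].
Proof.
move=> p21 p31 p14 p34 h1 h4 hx hy.
(* Replacing the smaller of [x], [y] by the larger leaves one unknown: [(a11 - a21) * x <= a31 * z]
   or [(a24 - a14) * y <= a34 * z]. *)
have [le_yx|lt_xy] := leP y x.
  have [] := @lt_half_of_dominated (a11 - a21) a31 x z p31; [lia | nia |].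
  by move=> h h' h''; split=> [/h|/h'|/h'']; lia.
have [] := @lt_half_of_dominated (a24 - a14) a34 y z p34; [lia | nia |].
by move=> h h' h''; split=> [/h|/h'|/h'']; lia.
Qed.

Lemma combination_below_is_trivial
    (a11 a12 a13 a14 a21 a22 a23 a24 a31 a32 a33 a34 l x y z : int) :
  all (fun a : int => 0 < a)
    [:: a11; a12; a13; a14; a21; a22; a23; a24; a31; a32; a33; a34] ->
  a21 + 2 * a31 < a11 -> Num.max a12 a22 < a32 < a12 + a22 ->
  a14 + 2 * a34 < a24 -> 0 < l <= 2 ->
  a11 * x - a21 * y - a31 * z <= a11 - a21 - a31 * l ->
  - a12 * x - a22 * y + a32 * z <= Num.max 0 (- a12 - a22 + a32 * l) ->
  - a13 * x - a23 * y - a33 * z <= 0 ->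
  - a14 * x + a24 * y - a34 * z <= - a14 + a24 - a34 * l ->
  [/\ x = 0, y = 0 & z = 0] \/ [/\ x = 1, y = 1 & z = l].
Proof.
move=> /and5P[p11 p12 p13 p14 /and5P[p21 p22 p23 p24 /and5P[p31 p32 p33 p34 _]]].
move=> hI hII hIII hl h1 h2 h3 h4.
have [] := @max_lt_half_of_dominated a11 a21 a31 a14 a24 a34 (x - 1) (y - 1)
  (z - l) p21 p31 p14 p34 hI hIII; [nia | nia |] => hle hlt hgt.
move: hII; rewrite gt_max => /andP[/andP[hII1 hII2] hII3].
(* All three terms of the third coordinate are then nonnegative, with sum at most 0. *)
have zero_of_nonpos : x <= 0 -> y <= 0 -> z <= 0 -> [/\ x = 0, y = 0 & z = 0].
  by move=> x0 y0 z0; split; nia.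
(* By (II), [a32 < a12 + a22 < 2 * a32]: the second coordinate of [u] is negative for [l = 1] and
   positive for [l = 2], which decides the maximum in [h2]. *)
have {hl} [l1|l2] : l = 1 \/ l = 2 by lia.
  have {}h2 : - a12 * x - a22 * y + a32 * z <= 0.
    by move: h2; rewrite l1 max_l; lia.
  rewrite {}l1 {h1 h4} in hle hlt hgt *.
  have [z_gt|z_le] := ltP 1 z.
    have /hgt[x_lt y_lt] : 0 < z - 1 by lia.
    (* By integrality [2 * x <= z] and [2 * y <= z], so [h2] would give [2 * a32 <= a12 + a22]. *)
    by have : a12 * (2 * x) + a22 * (2 * y) <= (a12 + a22) * z; nia.
  have [z_lt|z_ge] := ltP z 1.
    left; have /hlt[x0 y0] : z - 1 < 0 by lia.
    by apply: zero_of_nonpos; lia.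
  have z1 : z = 1 by lia.
  right; have /hle[x1 y1] : z - 1 <= 0 by lia.
  rewrite {}z1 in h2 *.
  (* Here [x <= 0] would give [a32 <= a22], and [y <= 0] would give [a32 <= a12]. *)
  have [x0|x0] := leP x 0; first by nia.
  have [y0|y0] := leP y 0; first by nia.
  by split; lia.
have {}h2 : - a12 * (x - 1) - a22 * (y - 1) + a32 * (z - 2) <= 0.
  by move: h2; rewrite l2 max_r; lia.
rewrite {}l2 {h1 h4} in hle hlt hgt *.
have [z_gt|z_le] := ltP 2 z.
  have /hgt[x_lt y_lt] : 0 < z - 2 by lia.
  have : a12 * (2 * (x - 1)) + a22 * (2 * (y - 1)) <= (a12 + a22) * (z - 2).
    by nia.
  by nia.
have [z_lt|z_ge] := ltP z 2.
  have /hlt[x0 y0] : z - 2 < 0 by lia.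
  (* With [x, y <= 0], the value [z = 1] would give [a12 + a22 <= a32]. *)
  have [z1|z0] : z = 1 \/ z <= 0 by lia.
    by rewrite z1 in h2; nia.
  by left; apply: zero_of_nonpos; lia.
have z2 : z = 2 by lia.
right; have /hle[x1 y1] : z - 2 <= 0 by lia.
by rewrite {}z2 in h2 *; split; nia.
Qed.

Lemma forall_ord4 (P : 'I_4 -> Prop) :
  P ord0 -> P 1 -> P 2 -> P ord_max -> forall i, P i.
Proof.
move=> P0 P1 P2 P3 [[|[|[|[|//]]]] lti].
- by congr (P _): P0; apply/val_inj.
- by congr (P _): P1; apply/val_inj.
- by congr (P _): P2; apply/val_inj.
- by congr (P _): P3; apply/val_inj.
Qed.

Theorem corollary4p9 (L : zmodClosed 'rV[int]_4) (c1 c2 c3 : 'rV[int]_4)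
    (mu lambda : int) :
  positive_lattice L -> has_rank L 3 -> admissible L c1 c2 c3 ->
  0 < mu -> 0 < lambda ->
  let u := mu *: c1 + c2 + lambda *: c3 in
  0 < u 0 ord0 -> 0 < u 0 ord_max ->
  neighbor L u <-> mu = 1 /\ lambda <= 2.
Proof.
move=> _ _ [[bL bgen _]].
move=> [a11 [a12 [a13 [a14 [a21 [a22 [a23 [a24 [a31 [a32 [a33 [a34 H]]]]]]]]]]]].
case: H => [[e1 e2 e3] pos hI hII hIII] mu0 la0 u u0 u3.
have c1L : c1 \in L := bL 0.
have c2L : c2 \in L := bL 1.
have c3L : c3 \in L := bL 2.
have gen w : w \in L -> exists x y z : int, w = x *: c1 + y *: c2 + z *: c3.
  move=> /bgen [a ->]; exists (a 0), (a 1), (a 2).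
  rewrite !big_ord_recl big_ord0 addr0 addrA /=.
  by congr (a _ *: _ + a _ *: _ + a _ *: _); apply/val_inj.
have combL (x y z : int) : x *: c1 + y *: c2 + z *: c3 \in L.
  have sL (k : int) v : v \in L -> k *: v \in L.
    by move=> vL; rewrite -[k]intz scaler_int rpredMz.
  by rewrite !rpredD ?sL.
have coord (x y z : int) (w := x *: c1 + y *: c2 + z *: c3) :
    [/\ w 0 ord0 = a11 * x - a21 * y - a31 * z,
        w 0 1 = - a12 * x - a22 * y + a32 * z,
        w 0 2 = - a13 * x - a23 * y - a33 * z
      & w 0 ord_max = - a14 * x + a24 * y - a34 * z].
  by rewrite /w e1 e2 e3; split; rewrite !mxE /=; ring.
have uE : u = mu *: c1 + 1 *: c2 + lambda *: c3 by rewrite scale1r.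
have [uc0 uc1 uc2 uc3] := coord mu 1 lambda.
rewrite -uE in uc0 uc1 uc2 uc3.
have uL : u \in L by rewrite uE.
have := pos.
move=> /and5P[p11 p12 p13 p14 /and5P[p21 p22 p23 p24 /and5P[p31 p32 p33 p34 _]]].
have u2 : u 0 2 < 0 by rewrite uc2; nia.
have [nbr1 nbr2] := neighborP uL u0 u2.
split=> [/nbr1 only | [mu1 la2]].
  move: hII; rewrite gt_max => /andP[/andP[hII1 hII2] hII3].
  rewrite uc0 in u0; rewrite uc3 in u3.
  (* Every nonzero [x c1 + z c3] with [x, z >= 0] has a negative fourth
     coordinate, hence differs from 0 and [u]. *)
  have excl (x z : int) : 0 <= x -> 0 <= z -> 0 < x + z ->
      a11 * x - a31 * z <= a11 * mu - a21 - a31 * lambda ->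
      - a12 * x + a32 * z <= Num.max 0 (- a12 * mu - a22 + a32 * lambda) ->
      False.
    move=> x0 z0 xz h1 h2; have [w0 w1 w2 w3] := coord x 0 z.
    have w3lt : (x *: c1 + 0 *: c2 + z *: c3) 0 ord_max < 0 by rewrite w3; nia.
    case: (only (x *: c1 + 0 *: c2 + z *: c3)) => //.
    - apply: forall_ord4.
      + by rewrite w0 uc0 le_max; apply/orP; right; lia.
      + by rewrite w1 uc1 mulr0 subr0 mulr1.
      + by rewrite w2 le_max; apply/orP; left; nia.
      + by rewrite le_max (ltW w3lt).
    - by move=> E; rewrite E mxE in w3lt.
    - by move=> E; rewrite E uc3 in w3lt; lia.
  have no_c3 : - a12 * mu - a22 + a32 * lambda < a32.
    by rewrite ltNge; apply/negP => h; apply: (excl 0 1) => //;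
      rewrite ?le_max; try apply/orP; lia.
  have no_c1 : a11 * mu - a21 - a31 * lambda < a11.
    by rewrite ltNge; apply/negP => h; apply: (excl 1 0) => //;
      rewrite ?le_max; try apply/orP; lia.
  have no_c13 : a11 - a31 <= a11 * mu - a21 - a31 * lambda ->
      a32 - a12 <= - a12 * mu - a22 + a32 * lambda -> False.
    by move=> h1 h2; apply: (excl 1 1) => //;
      rewrite ?le_max; try apply/orP; lia.
  (* For [mu = 1], [no_c3] reads [(lambda - 1) * a32 < a12 + a22], which is below [2 * a32]. *)
  have [mu1|mu2] : mu = 1 \/ 2 <= mu by lia.
    by split=> //; rewrite mu1 in no_c3; nia.
  exfalso; have la_le : lambda <= mu + 1 by nia.
  (* By [no_c1], [(mu - 1) * a11 < a21 + lambda * a31]. This contradicts (I) if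
     [lambda <= 2 * (mu - 1)], which [la_le] ensures for [mu >= 3]; only [mu = 2], [lambda = 3]
     needs [c1 + c3]. *)
  have [mu2'|mu3] : mu = 2 \/ 3 <= mu by lia.
    rewrite mu2' in no_c13 no_c1 la_le.
    have [la3|la2] : lambda = 3 \/ lambda <= 2 by lia.
      by rewrite la3 in no_c13; apply: no_c13; lia.
    by nia.
  have : (mu - 1) * (a21 + 2 * a31) <= (mu - 1) * a11 by nia.
  by nia.
apply: nbr2 => w /gen [x [y [z ->]]] wle.
have [w0 w1 w2 w3] := coord x y z.
have h0 := wle ord0; have h1 := wle 1; have h2 := wle 2; have h3 := wle ord_max.
rewrite w0 (max_r (ltW u0)) uc0 mu1 !mulr1 in h0.
rewrite w1 uc1 mu1 !mulr1 in h1.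
rewrite w2 (max_l (ltW u2)) in h2.
rewrite w3 (max_r (ltW u3)) uc3 mu1 !mulr1 in h3.
have l12 : 0 < lambda <= 2 by rewrite la0.
have [] := combination_below_is_trivial pos hI hII hIII l12 h0 h1 h2 h3.
- by case=> -> -> ->; left; rewrite !scale0r !addr0.
- by case=> -> -> ->; right; rewrite uE mu1.
Qed.
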